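(* Any streaming certification scheme for $\mathrm{MaxMatching}_{\geq}$ using $c$-bit certificates and $m$ bits of verifier work-memory on $n$-node graphs satisfies $c+m=\Omega(n)$.
   Context: Inputs are an $n$-node graph $G$ on vertex set $[n]$ together with an integer threshold $k$; the threshold $k$ is given first, and then the edges of $G$ arrive as a stream in an arbitrary, possibly adversarial, order. A streaming certification scheme for a decision problem $P$ consists of a prover and a verifier. The prover is a computationally unlimited function which, for each input, produces a certificate in $\{0,1\}^*$ depending only on the input (not on the order of the edges). The verifier is a deterministic streaming algorithm with read-only access to the certificate that processes the edge stream and outputs accept or reject at the end. Completeness: if the input satisfies $P$, there is a certificate such that for every edge order the verifier accepts. Soundness: if the input does not satisfy $P$, then for every certificate and every edge order the verifier rejects. Here $c$ is the certificate length and $m$ the verifier's memory excluding the read-only certificate, both as functions of $n$ in the worst case. $\mathrm{MaxMatching}_{\geq}$ asks whether the maximum matching of $G$ has size at least $k$. *)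

(* Defs.v *)
From mathcomp Require Import all_boot all_order all_algebra.

Set Implicit Arguments.
Unset Strict Implicit.
Unset Printing Implicit Defensive.

Definition edge (n : nat) := {e : {set 'I_n} | #|e| == 2}.

(* A simple graph on the vertex set 'I_n is identified with its edge set: edges
   are unordered pairs of distinct vertices, so every set of edges is a graph. *)
Definition graph (n : nat) := {set edge n}.

Definition is_matching n (G : graph n) (M : {set edge n}) : bool :=
  (M \subset G) && trivIset (val @: M).

Definition max_matching_size n (G : graph n) : nat :=
  \max_(M : {set edge n} | is_matching G M) #|M|.

Definition decision_problem := forall n : nat, int -> graph n -> bool.

Definition MaxMatching_ge : decision_problem :=
  fun n k G => (k <= (max_matching_size G)%:Z)%R.

Definition certificate := seq bool.

(* Each certificate w yields a deterministic automaton whose state is the m-bit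
   work memory. Its transitions are arbitrary functions of w, hence access to w
   and the computation between two stream items are free; anything remembered
   from earlier items (the threshold included) must be kept in the m bits. *)
Record verifier (n m : nat) := Verifier {
  (* memory after the threshold has been read *)
  start : certificate -> int -> m.-tuple bool;
  step : certificate -> m.-tuple bool -> edge n -> m.-tuple bool;
  output : certificate -> m.-tuple bool -> bool
}.

Definition accepts n m (V : verifier n m) (w : certificate) (k : int)
    (s : seq (edge n)) : bool :=
  output V w (foldl (step V w) (start V w k) s).

(* s lists every edge of G exactly once *)
Definition edge_order n (G : graph n) (s : seq (edge n)) : bool :=
  perm_eq s (enum G).

(* The functions c and m bound, for every n and over all inputs on n nodes, the
   certificate length and the work memory. Soundness is required against
   certificates of every length, not only those of length at most c n. *)
Record certification_scheme (P : decision_problem) (c m : nat -> nat) := Scheme {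
  prover : forall n : nat, int -> graph n -> certificate;
  verify : forall n : nat, verifier n (m n);
  prover_size : forall n (k : int) (G : graph n), size (prover k G) <= c n;
  completeness : forall n (k : int) (G : graph n), P n k G ->
    forall s, edge_order G s -> accepts (verify n) (prover k G) k s;
  soundness : forall n (k : int) (G : graph n), ~~ P n k G ->
    forall (w : certificate) s, edge_order G s -> ~~ accepts (verify n) w k s
}.

(* Main.v *)
Require Import Defs.
From mathcomp Require Import all_boot all_order all_algebra.
From mathcomp Require Import all_classical all_reals all_analysis.
From mathcomp Require Import zify lra.
Import GRing.Theory Num.Theory.
Import numFieldNormedType.Exports.

(** A fooling set of size 2^(n/3): cut the vertices into triples (a_i, b_i, c_i);
    for a set x of triples, stream first the edges a_i b_i with i in x, then the
    edges b_i c_i with i outside x.  These edges form a matching of size n/3.  If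
    two sets x <> y had the same certificate and led to the same memory after the
    first half of the stream, then, for i in y but not in x (up to symmetry), the
    first half for x followed by the second half for y would be accepted too; but
    its edges all meet some b_j with j <> i, so it has no matching of size n/3.
    Hence 2^(n/3) is at most the number of pairs (certificate, memory). *)

Lemma leq_max_matching_size {n} (G : graph n) (M : {set edge n}) :
  is_matching G M -> #|M| <= max_matching_size G.
Proof. by move=> MG; apply: (@leq_bigmax_cond _ _ _ M MG). Qed.

Lemma matching_share_vertex {n} {G : graph n} {M : {set edge n}} {e f v} :
    is_matching G M -> e \in M -> f \in M -> v \in val e -> v \in val f ->
  e = f.
Proof.
move=> /andP[_ /finset.trivIsetP tM] eM fM ve vf; apply/val_inj/eqP.
apply: contraTT vf => nef.
have /pred0P/(_ v) := tM _ _ (imset_f _ eM) (imset_f _ fM) nef.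
by rewrite /= ve /= => ->.
Qed.

(** Triples are blocks of three consecutive vertices; the at most two vertices left over stay
    isolated. *)
Definition vertex {n} (i : 'I_(n %/ 3)) (j : 'I_3) : 'I_n.
Proof. by exists (i * 3 + j); case: i j => [i Hi] [j Hj] /=; lia. Defined.

Lemma vertex_inj {n} (i i' : 'I_(n %/ 3)) (j j' : 'I_3) :
  vertex i j = vertex i' j' -> i = i' /\ j = j'.
Proof.
move=> /(congr1 val) /=; case: i i' j j' => [i Hi] [i' Hi'] [j Hj] [j' Hj'] /=.
by move=> E; split; apply/val_inj => /=; lia.
Qed.

Definition middle : 'I_3 := inord 1.
Definition outer (b : bool) : 'I_3 := if b then ord0 else ord_max.

Lemma middle_neq_outer b : middle != outer b.
Proof. by rewrite -val_eqE /= inordK //; case: b. Qed.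

Lemma outer_inj : injective outer.
Proof. by case=> [] [] // /(congr1 val). Qed.

(* [half_edge true i] is a_i b_i and [half_edge false i] is b_i c_i. *)
Definition half_edge {n} (b : bool) (i : 'I_(n %/ 3)) : edge n.
Proof.
exists [set vertex i middle; vertex i (outer b)]%SET.
rewrite cards2; suff -> : vertex i middle != vertex i (outer b) by [].
by apply/eqP => /vertex_inj[_ /eqP]; rewrite (negbTE (middle_neq_outer b)).
Defined.

Lemma mem_half_edge {n} b (i k : 'I_(n %/ 3)) j :
  (vertex k j \in val (half_edge b i)) = (k == i) && (j \in [:: middle; outer b]).
Proof.
rewrite /= !inE; apply/idP/idP.
- by case/orP => /eqP/vertex_inj[-> ->]; rewrite !eqxx ?orbT.
- by case/andP => /eqP-> /orP[]/eqP->; rewrite eqxx ?orbT.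
Qed.

Lemma half_edge_inj {n} b b' (i i' : 'I_(n %/ 3)) :
  half_edge b i = half_edge b' i' -> i = i' /\ b = b'.
Proof.
(* The outer vertex lies in no other half edge, so it determines both [i] and [b]. *)
move=> E; have := mem_half_edge b i i (outer b).
rewrite E mem_half_edge !inE !eqxx orbT eq_sym.
rewrite [outer b == _]eq_sym (negbTE (middle_neq_outer b)) /=.
by case/andP => /eqP-> /eqP/outer_inj->.
Qed.

Definition half_stream {n} (b : bool) (x : {set 'I_(n %/ 3)}) : seq (edge n) :=
  [seq half_edge b i | i <- enum x].

(** The case [x = y] is the honest stream for [x]; distinct sets give the spliced stream that fools
    the verifier. *)
Definition crossing_stream {n} (x y : {set 'I_(n %/ 3)}) : seq (edge n) :=
  half_stream true x ++ half_stream false (~: y)%SET.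

Definition crossing_graph {n} (x y : {set 'I_(n %/ 3)}) : graph n :=
  [set e in crossing_stream x y]%SET.

Lemma crossing_streamP {n} (x y : {set 'I_(n %/ 3)}) e :
  reflect (exists b i, (if b then i \in x else i \notin y) /\ e = half_edge b i)
          (e \in crossing_stream x y).
Proof.
rewrite mem_cat; apply: (iffP orP).
- case=> /mapP[i]; rewrite mem_enum => Hi ->; [exists true, i|exists false, i];
  by rewrite ?inE in Hi *.
- by case=> -[] [i [Hi ->]]; [left|right]; apply: map_f; rewrite mem_enum ?inE.
Qed.

Lemma crossing_stream_order {n} (x y : {set 'I_(n %/ 3)}) :
  edge_order (crossing_graph x y) (crossing_stream x y).
Proof.
apply: uniq_perm; rewrite ?enum_uniq //; last by move=> e; rewrite mem_enum inE.
rewrite cat_uniq !map_inj_uniq ?enum_uniq ?andbT //=; first last.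
- by move=> i j /half_edge_inj[].
- by move=> i j /half_edge_inj[].
by apply/hasPn => _ /mapP[i _ ->]; apply/mapP => -[j _ /half_edge_inj[]].
Qed.

Lemma crossing_graph_diag {n} (x : {set 'I_(n %/ 3)}) :
  n %/ 3 <= max_matching_size (crossing_graph x x).
Proof.
pose M := [set half_edge (i \in x) i | i : 'I_(n %/ 3)]%SET.
have <- : #|M| = n %/ 3.
  by rewrite card_imset ?card_ord // => i j /half_edge_inj[].
apply: leq_max_matching_size; apply/andP; split.
- apply/fintype.subsetP => _ /imsetP[i _ ->]; rewrite inE; apply/crossing_streamP.
  by exists (i \in x), i; split=> //; case: (boolP (i \in x)).
apply/finset.trivIsetP => _ _ /imsetP[_ /imsetP[i _ ->] ->] /imsetP[_ /imsetP[j _ ->] ->].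
have [->|nij _] := eqVneq i j; first by rewrite eqxx.
apply/pred0P => v; apply/negbTE/negP => /andP[/= vi].
by case/set2P: vi => ->; have := mem_half_edge (j \in x) j i;
  move=> /= ->; rewrite (negbTE nij).
Qed.

Lemma crossing_graph_missing {n} (x y : {set 'I_(n %/ 3)}) i :
  i \in y -> i \notin x -> max_matching_size (crossing_graph x y) < n %/ 3.
Proof.
move=> iy ix; have n3_gt0 : 0 < n %/ 3 by apply: leq_ltn_trans (ltn_ord i).
rewrite -(prednK n3_gt0) ltnS; apply/bigmax_leqP => M MG.
(* Both edges of triple [j] contain b_j, so [M] has at most one of them: [h j] is that edge, or a
   default if there is none. *)
pose h j := if half_edge true j \in M then half_edge true j else half_edge false j.
have MI : (M \subset h @: (~: [set i]))%SET.
  apply/fintype.subsetP => e eM; have /andP[/fintype.subsetP/(_ e eM)] := MG.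
  rewrite inE => /crossing_streamP[b [j [jxy eE]]] _; apply/imsetP; exists j.
    (* Triple [i] has no edge at all: its first edge would need [i \in x], its second
       [i \notin y]. *)
    by rewrite !inE; apply: contraTneq jxy => ->; case: b {eE}; rewrite ?iy.
  rewrite /h; case: ifP => [jM|]; last by case: b {jxy} eE eM => // -> ->.
  by apply: (matching_share_vertex (v := vertex j middle) MG eM jM);
    rewrite ?eE mem_half_edge !inE !eqxx.
apply: leq_trans (subset_leq_card MI) _; apply: leq_trans (leq_imset_card _ _) _.
by rewrite cardsC1 card_ord.
Qed.

(** Geometric sum: 1 + 2 + ... + 2^c = 2^(c+1) - 1. Allowing all lengths up to [c] costs one extra
    bit. *)
Lemma card_bseq_bool_leq c : #|{bseq c of bool}| <= 2 ^ c.+1.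
Proof.
by rewrite card_bseq card_bool -[leqLHS]mul1n -(predn_exp 2) leq_pred.
Qed.

Section Fooling.
Context {c m : nat -> nat} (S : certification_scheme MaxMatching_ge c m) (n : nat).
Implicit Types x y : {set 'I_(n %/ 3)}.

Let k : int := (n %/ 3)%:Z%R.
Let V := verify S n.
Let cert x : certificate := prover S k (crossing_graph x x).
Let memory x : (m n).-tuple bool :=
  foldl (step V (cert x)) (start V (cert x) k) (half_stream true x).

(** From equal memories, the second half for [y] is processed exactly as in the honest stream for
    [y], which completeness accepts. *)
Let crossing_accepted x y : cert x = cert y -> memory x = memory y ->
  accepts V (cert y) k (crossing_stream x y).
Proof.
move=> cxy; rewrite /memory cxy => mxy; rewrite /accepts foldl_cat mxy -foldl_cat.
apply: completeness (crossing_stream_order y y).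
exact: crossing_graph_diag.
Qed.

Let fooling_subset x y : cert x = cert y -> memory x = memory y -> y \subset x.
Proof.
move=> cxy mxy; apply/fintype.subsetP => i iy; apply/negPn/negP => ix.
have := crossing_accepted _ _ cxy mxy; apply/negP.
apply: soundness (crossing_stream_order x y).
by rewrite /MaxMatching_ge lez_nat -ltnNge; apply: crossing_graph_missing iy ix.
Qed.

Lemma certification_scheme_bound : n %/ 3 <= (c n + m n).+1.
Proof.
pose f x := (Bseq (prover_size S k (crossing_graph x x)) : {bseq c n of bool},
             memory x).
have f_inj : injective f.
  move=> x y [cxy mxy].
  (* The two hypotheses are symmetric in [x] and [y], so inclusion holds both ways. *)
  by apply/eqP; rewrite finset.eqEsubset !fooling_subset.
have := leq_card f f_inj.
rewrite card_prod card_tuple card_bool -cardsT -powersetT card_powerset cardsT.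
rewrite card_ord => le_card; rewrite -(leq_exp2l (m := 2)) // -addSn expnD.
by apply: leq_trans le_card _; rewrite leq_mul2r card_bseq_bool_leq orbT.
Qed.

End Fooling.

Local Open Scope ring_scope.
Local Open Scope classical_set_scope.

Theorem theorem7 (R : realType) (c m : nat -> nat)
    (S : certification_scheme MaxMatching_ge c m) :
  (fun n : nat => (c n + m n)%:R : R) \is 'Omega_\oo (fun n : nat => n%:R : R).
Proof.
(* Rounding in [n %/ 3] gives n <= 3(c + m) + 5, hence 2n - 10 <= 6(c + m), and n <= 2n - 10 once n
   >= 10. *)
apply/asboolP; exists (1 / 6) => //=.
near=> n; rewrite !normr_nat.
have n_ge10 : (10 <= n)%N by near: n; exact: nbhs_infty_ge.
have bound := certification_scheme_bound S n.
have : (n <= 6 * (c n + m n))%N by lia.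
by rewrite -(ler_nat R) natrM; lra.
Unshelve. all: by end_near.
Qed.
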